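(* Let $k$ be a positive integer and let $L_{2k}$ be the ladder graph of order $2k$. Then $L_{2k}$ admits a $2$-graceful $\alpha$-labeling if and only if $k$ is even.
   Context: The ladder graph $L_{2k}$ is the cartesian product $P_2\times P_k$ of the path $P_2=(0\sim 1)$ with the path $P_k=(0\sim 1\sim\cdots\sim k-1)$; it has $2k$ vertices and $3k-2$ edges. For a graph $\Gamma$ of size $e$ and a divisor $d$ of $e$ with $e=d\cdot m$, a $d$-graceful labeling of $\Gamma$ is an injective function $f:V(\Gamma)\to\{0,1,\ldots,d(m+1)-1\}$ such that $\{|f(x)-f(y)| : [x,y]\in E(\Gamma)\}=\{1,2,\ldots,d(m+1)-1\}\setminus\{m+1,2(m+1),\ldots,(d-1)(m+1)\}$; this notion is only defined when $d$ divides $e$ (so no $d$-graceful labeling exists otherwise). If $\Gamma$ is bipartite with parts $X,Y$, a $d$-graceful $\alpha$-labeling is a $d$-graceful labeling $f$ such that $\max f(X)<\min f(Y)$ for a suitable ordering of the two parts. *)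

(* Defs.v *)
From mathcomp Require Import all_boot all_order all_algebra.

Set Implicit Arguments.
Unset Strict Implicit.
Unset Printing Implicit Defensive.

Record sgraph := SGraph {
  vertex :> finType;
  adj : rel vertex;
  adj_sym : symmetric adj;
  adj_irrefl : irreflexive adj
}.

Definition edges (G : sgraph) : {set {set G}} :=
  [set [set p.1; p.2] | p in [set p : G * G | adj p.1 p.2]].

Definition gsize (G : sgraph) : nat := #|edges G|.

Section Path.
Variable k : nat.

Definition path_adj : rel 'I_k := fun i j => (i.+1 == j) || (j.+1 == i).

Fact path_adj_sym : symmetric path_adj.
Proof. by move=> i j; rewrite /path_adj orbC. Qed.

Fact path_adj_irrefl : irreflexive path_adj.
Proof. by move=> i; rewrite /path_adj orbb gtn_eqF. Qed.

Definition path_graph : sgraph := SGraph path_adj_sym path_adj_irrefl.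
End Path.

Section CartesianProduct.
Variables G H : sgraph.

Definition cart_adj : rel (G * H) := fun u v =>
  (u.1 == v.1) && adj u.2 v.2 || adj u.1 v.1 && (u.2 == v.2).

Fact cart_adj_sym : symmetric cart_adj.
Proof.
move=> u v; rewrite /cart_adj (eq_sym u.1) (eq_sym u.2).
by rewrite (adj_sym u.1) (adj_sym u.2).
Qed.

Fact cart_adj_irrefl : irreflexive cart_adj.
Proof. by move=> u; rewrite /cart_adj !adj_irrefl andbF. Qed.

Definition cart_graph : sgraph := SGraph cart_adj_sym cart_adj_irrefl.
End CartesianProduct.

(* The ladder L_{2k}: the index k is half the order. *)
Definition ladder (k : nat) : sgraph := cart_graph (path_graph 2) (path_graph k).

Definition graceful_labeling (d : nat) (G : sgraph) (f : G -> nat) : Prop :=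
  let m := gsize G %/ d in
  [/\ 0 < d, d %| gsize G, injective f,
      forall x, f x <= d * (m + 1) - 1
    & forall n : nat,
        (exists x y : G, adj x y /\ `|f x - f y|%N = n) <->
        1 <= n <= d * (m + 1) - 1 /\
        ~ exists i, 1 <= i <= d - 1 /\ n = i * (m + 1)].

Definition bipartition (G : sgraph) (X Y : {set G}) : Prop :=
  [/\ X :|: Y = [set: G], [disjoint X & Y]
    & forall x y : G, adj x y ->
        (x \in X) && (y \in Y) || (x \in Y) && (y \in X)].

(* max f(X) < min f(Y) is written pointwise; quantifying over the pair (X, Y)
   covers both orderings of the parts. *)
Definition graceful_alpha_labeling (d : nat) (G : sgraph) (f : G -> nat) : Prop :=
  graceful_labeling d f /\
  exists X Y : {set G}, bipartition X Y /\
    forall x y : G, x \in X -> y \in Y -> f x < f y.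

(* Main.v *)
Require Import Defs.
From mathcomp Require Import all_boot all_order all_algebra.
From mathcomp Require Import zify.

Set Implicit Arguments.
Unset Strict Implicit.
Unset Printing Implicit Defensive.

(** The ladder has [3k - 2] edges, which is even exactly when [k] is, so [k]
    must be even.  Conversely let [k = 2t], and in column [j] give the vertex
    of one part the label [j] and the vertex of the other part the label
    [6t - 1 - 2j], lowered by one when [j >= t].  Reading rungs and rails from
    left to right, the differences decrease by one at each edge, except that
    the shift at the middle of the ladder makes them skip [3t]. *)

Lemma ladder_adjE (k : nat) (u v : ladder k) :
  adj u v = [&& u.1 == v.1 :> nat & (u.2.+1 == v.2 :> nat) || (v.2.+1 == u.2 :> nat)]
    || ((u.1 != v.1 :> nat) && (u.2 == v.2 :> nat)).
Proof.
case: u v => [a i] [b j]; rewrite /= /cart_adj /= /path_adj -!val_eqE /=.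
by have := ltn_ord a; have := ltn_ord b; lia.
Qed.

Lemma ladder_eqE (k : nat) (u v : ladder k) :
  (u == v) = (u.1 == v.1 :> nat) && (u.2 == v.2 :> nat).
Proof. by rewrite -pair_eqE. Qed.

(** A repetition-free index of the edges, so that the size becomes the cardinality of a sum type:
    [inl] gives the rungs, [inr] the rails, each named by its row and left column. *)
Definition ladder_edge (n : nat) (e : 'I_n.+1 + 'I_2 * 'I_n) :
    {set ladder n.+1} :=
  match e with
  | inl j => [set (ord0, j); (ord_max, j)]
  | inr (r, j) => [set (r, widen_ord (leqnSn n) j); (r, lift ord0 j)]
  end.

Lemma ladder_edge_inj (n : nat) : injective (@ladder_edge n).
Proof.
have E (u v x y : ladder n.+1) : [set u; v] = [set x; y] ->
    [/\ (u == x) || (u == y), (v == x) || (v == y),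
        (x == u) || (x == v) & (y == u) || (y == v)].
  move=> /setP E; split.
  - by have := E u; rewrite !inE eqxx.
  - by have := E v; rewrite !inE eqxx orbT.
  - by have := E x; rewrite !inE eqxx.
  - by have := E y; rewrite !inE eqxx orbT.
move=> [j|[r j]] [j'|[r' j']] /E; rewrite !ladder_eqE /= /bump => -[] *.
- by congr inl; apply/val_inj => /=; lia.
- by exfalso; lia.
- by exfalso; lia.
- by congr (inr (_, _)); apply/val_inj => /=; lia.
Qed.

Lemma edges_ladder (n : nat) :
  edges (ladder n.+1) = [set ladder_edge e | e in [set: 'I_n.+1 + 'I_2 * 'I_n]].
Proof.
apply/setP => S; apply/imsetP/imsetP => [[[u v]] | [[j|[r j]] _ ->]]; last 2 first.
- exists ((ord0, j), (ord_max, j)); rewrite // inE ladder_adjE /=; lia.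
- exists ((r, widen_ord (leqnSn n) j), (r, lift ord0 j)) => //.
  by rewrite inE ladder_adjE /= /bump; lia.
rewrite inE [fst _]/= [snd _]/= => uv ->.
(* Orients the edge as [ladder_edge] does: rungs from row 0 to row 1, rails from left to right. *)
wlog le_uv : u v uv / (u.1 + u.2 <= v.1 + v.2)%N.
  move=> W; case: (leqP (u.1 + u.2) (v.1 + v.2)) => [|/ltnW] h; first exact: W.
  by rewrite setUC; apply: W; rewrite // adj_sym.
case: u v uv le_uv => [a i] [b j]; rewrite ladder_adjE /= => uv le_uv.
have [a2 b2 ik jk] := And4 (ltn_ord a) (ltn_ord b) (ltn_ord i) (ltn_ord j).
have [ab|ab] := eqVneq (a : nat) b.
- have ltin : i < n by lia.
  exists (inr (a, Ordinal ltin)); rewrite ?in_setT //=; congr [set _; _];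
    by apply/eqP; rewrite ladder_eqE /= /bump; lia.
- exists (inl i); rewrite ?in_setT //=; congr [set _; _];
    by apply/eqP; rewrite ladder_eqE /=; lia.
Qed.

Lemma gsize_ladder (n : nat) : gsize (ladder n.+1) = 3 * n + 1.
Proof.
rewrite /gsize edges_ladder card_imset; last exact: ladder_edge_inj.
by rewrite cardsT card_sum card_prod !card_ord; lia.
Qed.

(** An edge changes exactly one coordinate, and by one; the parity of the coordinate sum thus gives
    the bipartition. *)
Lemma ladder_adj_odd (k : nat) (u v : ladder k) :
  adj u v -> odd (v.1 + v.2) = ~~ odd (u.1 + u.2).
Proof.
rewrite ladder_adjE !oddD => /orP[/andP[/eqP -> /orP[]/eqP <-]|/andP[ne /eqP ->]].
- by rewrite oddS addbN.
- by rewrite oddS addbN negbK.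
move: (ltn_ord u.1) (ltn_ord v.1) ne.
by case: (u.1 : nat) (v.1 : nat) => [|[|?]] [|[|?]] // _ _ _ /=; case: odd.
Qed.

Definition near (i j : nat) : bool := [|| i == j, i.+1 == j | j.+1 == i].

Lemma ladder_adj_near (k : nat) (u v : ladder k) : adj u v -> near u.2 v.2.
Proof.
rewrite ladder_adjE /near.
by case/orP=> /andP[_ ->]; rewrite ?orbT.
Qed.

Definition high_label (t j : nat) : nat := 6 * t - 1 - 2 * j - (t <= j).

(** The smallest high label, in column [2 * t - 1], is [2 * t], above all low labels. This gives the
    alpha condition and keeps the truncated subtractions exact. *)
Lemma high_label_gt (t i j : nat) :
  i < t.*2 -> j < t.*2 -> j < high_label t i.
Proof. by rewrite /high_label; case: leqP => /= *; lia. Qed.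

Lemma high_label_inj (t i j : nat) : i < t.*2 -> j < t.*2 ->
  high_label t i = high_label t j -> i = j.
Proof. by rewrite /high_label; case: leqP; case: leqP => /= *; lia. Qed.

(** Without the shift, [3 * t] would occur only for [i = t], [j = t - 1]; the shift turns it into
    [3 * t - 1]. *)
Lemma high_label_diff (t i j : nat) : i < t.*2 -> j < t.*2 -> near i j ->
  high_label t i - j <= 6 * t - 1 /\ high_label t i - j <> 3 * t.
Proof.
rewrite /high_label => it jt /or3P[]/eqP ij; subst.
all: by case: leqP => /= ti; split; lia.
Qed.

Lemma high_label_diff_surj (t n : nat) :
  1 <= n <= 6 * t - 1 -> n <> 3 * t ->
  exists i j, [/\ i < t.*2, j < t.*2, near i j & high_label t i - j = n].
Proof.
move=> /andP[n_gt0 n_max] n_mid.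
(* The rank of the edge with difference [n], from left to right, counts three
   edges per column: a rung and the two rail edges to its right. *)
pose rank := 6 * t - 1 - n - (n < 3 * t).
have [c [r [r3 rankE]]] : exists c r, r < 3 /\ rank = 3 * c + r.
  by exists (rank %/ 3), (rank %% 3); rewrite ltn_mod mulnC -divn_eq.
(* Here [i] is the column of the high end and [j] that of the low end: [r = 0] is the rung of column
   [c], [r = 1] the rail with its high end there, [r = 2] the rail with its low end there. *)
pose i := if r == 2 then c.+1 else c; pose j := if r == 1 then c.+1 else c.
exists i, j; move: rankE; rewrite /i /j /rank /near /high_label {i j rank}.
case: r r3 => [|[|[|//]]] _ /=; rewrite ?eqxx ?orbT.
all: case: ltnP => /= n_cmp rankE; split=> //; try lia.
all: by case: leqP => /= *; lia.
Qed.

Definition ladder_label (t k : nat) (u : ladder k) : nat :=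
  if odd (u.1 + u.2) then high_label t u.2 else u.2.

Lemma ladder_label_inj (t : nat) : injective (@ladder_label t t.*2).
Proof.
move=> u v; rewrite /ladder_label.
have [u2 v2] := (ltn_ord u.2, ltn_ord v.2).
have gt := high_label_gt; move: (gt _ _ _ u2 v2) (gt _ _ _ v2 u2) => {gt} uv vu.
have coord : odd (u.1 + u.2) = odd (v.1 + v.2) -> u.2 = v.2 :> nat -> u = v.
  move=> + uv2; rewrite !oddD uv2 => /addIb odd1.
  apply/eqP; rewrite ladder_eqE uv2 eqxx andbT.
  move: (ltn_ord u.1) (ltn_ord v.1) odd1.
  by case: (u.1 : nat) (v.1 : nat) => [|[|?]] [|[|?]].
case: ifP => ou; case: ifP => ov E.
- apply: coord; first by rewrite ou ov.
  exact: high_label_inj u2 v2 E.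
- by rewrite E ltnn in uv.
- by rewrite E ltnn in vu.
- by apply: coord; first by rewrite ou ov.
Qed.

Lemma ladder_label_diff (t : nat) (u v : ladder t.*2) :
  adj u v ->
  let n := `|ladder_label t u - ladder_label t v|%N in
  1 <= n <= 6 * t - 1 /\ n <> 3 * t.
Proof.
(* By symmetry, [u] may be taken as the end with the high label. *)
wlog ou : u v / odd (u.1 + u.2).
  move=> W uv; case ou: (odd (u.1 + u.2)); first exact: W.
  by rewrite distnC; apply: W; rewrite ?(ladder_adj_odd uv) ?ou // adj_sym.
move=> uv n; rewrite {}/n; have gt := high_label_gt (ltn_ord u.2) (ltn_ord v.2).
rewrite /ladder_label (ladder_adj_odd uv) ou /= (distnEl (ltnW gt)) subn_gt0 gt /=.
exact: high_label_diff (ltn_ord u.2) (ltn_ord v.2) (ladder_adj_near uv).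
Qed.

Lemma ladder_label_diff_near (t i j : nat) :
  i < t.*2 -> j < t.*2 -> near i j ->
  exists u v : ladder t.*2,
    adj u v /\ `|ladder_label t u - ladder_label t v|%N = high_label t i - j.
Proof.
move=> it jt ij.
have row (b : bool) : b < 2 by case: b.
(* The rows are forced by parity: the coordinate sum must be odd in column [i] and even in column
   [j]. *)
exists (Ordinal (row (~~ odd i)), Ordinal it), (Ordinal (row (odd j)), Ordinal jt).
split.
  rewrite ladder_adjE /=; case/or3P: ij => /eqP ij; subst=> /=.
  - by rewrite eqxx; case: odd.
  - by rewrite !eqxx.
  - by rewrite negbK !eqxx orbT.
rewrite /ladder_label /= !oddD !oddb addNb !addbb /=.
by rewrite distnEl // ltnW // high_label_gt.
Qed.

Lemma ladder_label_graceful_alpha (t : nat) :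
  0 < t -> graceful_alpha_labeling 2 (@ladder_label t t.*2).
Proof.
move=> t_gt0; split.
  (* So [m + 1 = 3 * t]: the labels go up to [6 * t - 1] and the only excluded difference is
     [3 * t]. *)
  have szE : gsize (ladder t.*2) = 2 * (3 * t - 1).
    have -> : t.*2 = t.*2.-1.+1 by lia.
    by rewrite gsize_ladder; lia.
  rewrite /graceful_labeling szE mulKn // dvdn_mulr //.
  split=> //; first exact: ladder_label_inj.
    move=> u; have := ltn_ord u.2.
    by rewrite /ladder_label /high_label; case: ifP => _; lia.
  move=> n; split=> [[u [v [/ladder_label_diff [n1 n2] <-]]]|[n1 n2]].
    split; first lia.
    by move=> [i [i1 i2]]; have i_eq1 : i = 1 by [lia]; subst i; lia.
  have [||i [j [it jt ij <-]]] := @high_label_diff_surj t n; [lia| |].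
    by move=> nE; apply: n2; exists 1; lia.
  exact: ladder_label_diff_near.
exists [set u : ladder t.*2 | ~~ odd (u.1 + u.2)],
  [set u : ladder t.*2 | odd (u.1 + u.2)]; split.
  split.
  - by apply/setP => u; rewrite !inE; case: odd.
  - by rewrite -setI_eq0; apply/eqP/setP => u; rewrite !inE; case: odd.
  - by move=> u v /ladder_adj_odd uv; rewrite !inE uv; case: odd.
move=> u v; rewrite !inE /ladder_label => /negbTE -> ->.
exact: high_label_gt (ltn_ord v.2) (ltn_ord u.2).
Qed.

Theorem theorem4p5 (k : nat) (hk : 0 < k) :
  (exists f : ladder k -> nat, graceful_alpha_labeling 2 f) <-> ~~ odd k.
Proof.
split=> [[f [[_ dvd2 _ _ _] _]]|evk].
  by case: k hk f dvd2 => // n _ _; rewrite gsize_ladder; lia.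
have -> : k = k./2.*2 by lia.
by exists (@ladder_label k./2 k./2.*2); apply: ladder_label_graceful_alpha; lia.
Qed.
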